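(* Let $a<b$ be real numbers, let $f:[a,b]\to\mathbb{R}$ be continuous, and let $c\in(a,b)$ be the unique root of $f$ in $[a,b]$. Suppose that $f$ is differentiable on $A=(a,c)\cup(c,b)$ with $f'(x)\le 2$ for each $x\in A$. Suppose also that $f(x)<0$ for each $x\in[a,c)$ and $f(x)>0$ for each $x\in(c,b]$. For any $x_0\in[a,b]$ define, for each $n\ge 0$, $$x_{n+1}=x_n-\frac{f(x_n)}{2}.$$ Then the sequence $\{x_n\}$ converges to $c$.
   Context: A root of $f$ is a point $x$ of its domain with $f(x)=0$. The assertion that the recursively defined sequence converges includes that it is well defined, i.e. every $x_n$ lies in the domain $[a,b]$ of $f$. *)

(* Defs.v *)
From HB Require Import structures.
From mathcomp Require Import all_boot all_order all_algebra.
From mathcomp Require Import all_classical all_reals all_analysis.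

(* Main.v *)
Require Import Defs.
From HB Require Import structures.
From mathcomp Require Import all_boot all_order all_algebra.
From mathcomp Require Import all_classical all_reals all_analysis.
From mathcomp Require Import lra.

(* By the mean value theorem and the bound f' <= 2, the map y - f(y)/2 does not
   jump over c from either side, while the sign of f makes it move towards c.
   So the iterates stay on the side of c where they start and are monotone; the
   limit is a fixed point of y - f(y)/2 by continuity, that is, a root of f. *)

Set Implicit Arguments.
Unset Strict Implicit.
Unset Printing Implicit Defensive.
Import Order.TTheory GRing.Theory Num.Theory.
Import numFieldNormedType.Exports.
Local Open Scope classical_set_scope.
Local Open Scope ring_scope.

(** This is the mean value theorem; derivatives enter only inside []p, q[], so an endpoint may be a
    point such as [c]. The case [p = q] is split off because [MVT] asks for [p < q]. *)
Lemma le_increment_derive1 (R : realType) (f : R -> R) (k p q : R) :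
  p <= q ->
  (forall y, y \in `]p, q[ -> derivable f y 1) ->
  (forall y, y \in `]p, q[ -> f^`()%classic y <= k) ->
  {within `[p, q], continuous f} ->
  f q - f p <= k * (q - p).
Proof.
rewrite le_eqVlt => /predU1P[<- _ _ _|pq df dfk fc].
  by rewrite !subrr mulr0.
have fdrv y : y \in `]p, q[ -> is_derive y 1 f (f^`()%classic y).
  by move=> /df/derivableP; rewrite derive1E.
have [y yI ->] := MVT pq fdrv fc.
by rewrite ler_wpM2r ?dfk// subr_ge0 ltW.
Qed.

(** Closedness keeps the limit in [D]; then [g (u n)] tends to [g l] by continuity and to [l] as the
    shifted sequence, and limits in a Hausdorff space are unique. *)
Lemma cvg_iterates_fixpoint (T : ptopologicalType) (D : set T) (g : T -> T)
    (u : nat -> T) (l : T) :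
  hausdorff_space T -> closed D -> {within D, continuous g} ->
  (forall n, D (u n)) -> (forall n, u n.+1 = g (u n)) ->
  u @ \oo --> l -> D l /\ g l = l.
Proof.
move=> hT cD gc uD urec ul.
have Dl : D l by apply: (closed_cvg _ cD _ _ ul); exact: nearW.
split=> //.
have gul : g (u n) @[n --> \oo] --> g l.
  (* Continuity within [D] controls only the points of [D] near [l], which is enough since every
     [u n] lies in [D]. *)
  apply: cvg_trans (proj1 (@subspace_continuousP _ D _ g) gc l Dl).
  move=> A /= /ul [N _ NA]; exists N => // n Nn.
  by apply: NA => //; exact: uD.
have gul' : g (u n) @[n --> \oo] --> l.
  by move: ul; rewrite -cvg_shiftS /mk_sequence (funext urec).
exact: cvg_unique gul gul'.
Qed.

(* MathComp-Analysis. [f] is total; only its values on [a, b] are constrained,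
   and the first conjunct says that the recursion never leaves [a, b]. *)
Theorem corollary2p2 (R : realType) (a b c : R) (f : R -> R)
  (ltab : a < b)
  (f_cont : {within `[a, b], continuous f})
  (c_in : c \in `]a, b[)
  (c_root : f c = 0)
  (c_uniq : forall y, y \in `[a, b] -> f y = 0 -> y = c)
  (f_diff : forall y, (`]a, c[ `|` `]c, b[) y -> derivable f y 1)
  (f_deriv_le2 : forall y, (`]a, c[ `|` `]c, b[) y -> f^`()%classic y <= 2)
  (f_neg : forall y, y \in `[a, c[ -> f y < 0)
  (f_pos : forall y, y \in `]c, b] -> 0 < f y)
  (x0 : R) (x0_in : x0 \in `[a, b])
  (x : nat -> R)
  (x_init : x 0%N = x0)
  (x_rec : forall n : nat, x n.+1 = x n - f (x n) / 2) :
  (forall n : nat, x n \in `[a, b]) /\ x @ \oo --> c.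
Proof.
move: (c_in); rewrite in_itv/= => /andP[ac cb].
(* The increment bound on [[c, y]] with [f c = 0] gives [f y / 2 <= y - c], so there is no
   overshoot; [0 <= f y] gives the other inequality. *)
have right_step y : c <= y <= b -> c <= y - f y / 2 <= y.
  case/andP=> cy yb.
  have : f y - f c <= 2 * (y - c).
    apply: le_increment_derive1 => // [z|z|].
    - rewrite in_itv/= => /andP[cz zy]; apply: f_diff; right.
      by rewrite /= in_itv/= cz (lt_le_trans zy).
    - rewrite in_itv/= => /andP[cz zy]; apply: f_deriv_le2; right.
      by rewrite /= in_itv/= cz (lt_le_trans zy).
    - apply: continuous_subspaceW f_cont => z /=.
      by rewrite !in_itv/= => /andP[cz zy]; apply/andP; split; lra.
  have : 0 <= f y.
    move: cy; rewrite le_eqVlt => /predU1P[<-|cy]; first by rewrite c_root.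
    by rewrite ltW// f_pos// in_itv/= cy.
  by rewrite c_root => *; apply/andP; split; lra.
have left_step y : a <= y <= c -> y <= y - f y / 2 <= c.
  case/andP=> ay yc.
  have : f c - f y <= 2 * (c - y).
    apply: le_increment_derive1 => // [z|z|].
    - rewrite in_itv/= => /andP[yz zc]; apply: f_diff; left.
      by rewrite /= in_itv/= zc (le_lt_trans ay).
    - rewrite in_itv/= => /andP[yz zc]; apply: f_deriv_le2; left.
      by rewrite /= in_itv/= zc (le_lt_trans ay).
    - apply: continuous_subspaceW f_cont => z /=.
      by rewrite !in_itv/= => /andP[yz zc]; apply/andP; split; lra.
  have : f y <= 0.
    move: yc; rewrite le_eqVlt => /predU1P[->|yc]; first by rewrite c_root.
    by rewrite ltW// f_neg// in_itv/= ay.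
  by rewrite c_root => *; apply/andP; split; lra.
have g_cont : {within `[a, b], continuous (fun y => y - f y / 2)}.
  move=> y; apply: cvgB; last by apply: cvgM; [exact: f_cont|exact: cvg_cst].
  by apply: continuous_subspaceT => z; exact: cvg_id.
suff [x_ab x_cvg] : (forall n, x n \in `[a, b]) /\ cvgn x.
  split=> //; have [l_ab gl] := cvg_iterates_fixpoint (@norm_hausdorff R R)
    (@interval_closed _ (BLeft a) (BRight b) isT isT) g_cont x_ab x_rec x_cvg.
  (* A fixed point of [y - f y / 2] is a root of [f], so the limit is [c]. *)
  rewrite -(c_uniq (limn x))//.
  by move: gl; lra.
move: x0_in; rewrite -x_init in_itv/= => /andP[ax0 x0b].
(* The start [x 0 = c] falls under the first case, where [right_step] allows equality. *)
case: (leP c (x 0%N)) => [cx0|/ltW x0c].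
- have x_in n : c <= x n <= b.
    elim: n => [|n IH]; first by rewrite cx0.
    have /andP[] := right_step _ IH; rewrite -x_rec => -> /le_trans; apply.
    by case/andP: IH.
  split=> [n|]; first by case/andP: (x_in n) => cx xb; rewrite in_itv/= xb (le_trans (ltW ac)).
  apply: nonincreasing_is_cvgn.
    apply/nonincreasing_seqP => n.
    by rewrite x_rec; case/andP: (right_step _ (x_in n)).
  by exists c => _ [n _ <-]; case/andP: (x_in n).
(* Mirror case: the iterates do not decrease, so the bound by [a] persists, and [c] bounds them
   above. *)
- have x_in n : a <= x n <= c.
    elim: n => [|n IH]; first by rewrite ax0.
    have /andP[] := left_step _ IH; rewrite -x_rec => xS ->; rewrite andbT.
    by apply: le_trans xS; case/andP: IH.
  split=> [n|]; first by case/andP: (x_in n) => ax xc; rewrite in_itv/= ax (le_trans xc) ?ltW.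
  apply: nondecreasing_is_cvgn.
    apply/nondecreasing_seqP => n.
    by rewrite x_rec; case/andP: (left_step _ (x_in n)).
  by exists c => _ [n _ <-]; case/andP: (x_in n).
Qed.
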